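(* Let $G$ be a baseline cdf with quantile function $Q_G$, let $a,b,m,n>0$, and let $Q_{m,n}$ denote the quantile function of the beta distribution with parameters $m,n$ (the inverse of $x\mapsto I_x(m,n)$ on $(0,1)$). Then for every $u\in(0,1)$ the quantile function $Q(u)=F^{-1}(u)$ of the $BKw\text{-}G$ distribution with parameters $a,b,m,n$ is $$Q(u)=Q_G\left(\left[1-\{1-Q_{m,n}(u)\}^{1/b}\right]^{1/a}\right).$$
   Context: $G$ is the cdf of an absolutely continuous distribution on $(0,\infty)$. The quantile function of a cdf $F$ is $F^{-1}(u)=\inf\{t:F(t)\ge u\}$ (the ordinary inverse when $F$ is invertible). $B(m,n)$ is the beta function and $I_x(m,n)=B(m,n)^{-1}\int_0^x v^{m-1}(1-v)^{n-1}\,dv$. The Beta Kumaraswamy-$G$ ($BKw\text{-}G$) distribution with parameters $a,b,m,n>0$ has cdf $F^{BKwG}(t;a,b,m,n)=I_{1-[1-G(t)^a]^b}(m,n)$. *)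

(* Defs.v *)
From HB Require Import structures.
From mathcomp Require Import all_boot all_order all_algebra.
From mathcomp Require Import all_classical all_reals all_analysis.

Set Implicit Arguments.
Unset Strict Implicit.
Unset Printing Implicit Defensive.

Import Order.TTheory GRing.Theory Num.Theory.
Import numFieldNormedType.Exports.

Local Open Scope classical_set_scope.
Local Open Scope ring_scope.

(* [inf] is a genuine infimum here only for nonempty sets bounded below; for a
   cdf [F] this is the case for every [u] in ]0, 1[. *)
Definition quantile (R : realType) (F : R -> R) (u : R) : R :=
  inf [set t | u <= F t].

(* The library's [beta_fun] and [beta_prob] only take natural parameters. *)
Definition beta_integrand (R : realType) (m n v : R) : R :=
  v `^ (m - 1) * (1 - v) `^ (n - 1).

Definition rbeta_fun (R : realType) (m n : R) : R :=
  \int[@lebesgue_measure R]_(v in `[0, 1]) beta_integrand m n v.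

Definition reg_inc_beta (R : realType) (m n x : R) : R :=
  (rbeta_fun m n)^-1 *
  \int[@lebesgue_measure R]_(v in `[0, x]) beta_integrand m n v.

(* [reg_inc_beta] is meaningful on [0, 1] only: [powR] of a negative base is a
   junk value. Outside [0, 1] the cdf of the beta distribution is constant. *)
Definition beta_cdf (R : realType) (m n x : R) : R :=
  if x <= 0 then 0 else if 1 <= x then 1 else reg_inc_beta m n x.

Definition beta_quantile (R : realType) (m n : R) : R -> R :=
  quantile (beta_cdf m n).

Definition bkwg_cdf (R : realType) (G : R -> R) (a b m n t : R) : R :=
  reg_inc_beta m n (1 - (1 - G t `^ a) `^ b).

Definition abs_continuous_positive_cdf (R : realType) (G : R -> R) : Prop :=
  exists P : probability (measurableTypeR R) R,
    [/\ P `<< @lebesgue_measure R,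
        P `]0, +oo[%classic = 1%E &
        forall t, (G t)%:E = P `]-oo, t]%classic].

(* Main.v *)
Require Import Defs.
From mathcomp Require Import all_boot all_order all_algebra.
From mathcomp Require Import all_classical all_reals all_analysis.
From mathcomp Require Import measurable_realfun lra.

Import Order.TTheory GRing.Theory Num.Theory.
Import numFieldNormedType.Exports.

Local Open Scope classical_set_scope.
Local Open Scope ring_scope.

(** The function K : g |-> 1 - (1 - g^a)^b and its inverse
    q |-> (1 - (1 - q)^(1/b))^(1/a) are increasing bijections of [0, 1], so
    q <= K(g) iff K^-1(q) <= g (kumaraswamy_galois). For a nondecreasing
    right-continuous function F that crosses the level u, the infimum defining
    the quantile is attained, which gives the analogous equivalence
    quantile F u <= x iff u <= F x (quantile_galois). Applied to the beta cdf,
    the condition u <= I_(K(G t))(m, n) defining the left-hand quantile says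
    Q_(m,n)(u) <= K(G t), i.e., K^-1(Q_(m,n)(u)) <= G t. The two sides of the
    theorem are therefore infima of the same set of reals t.

    What remains is that the beta cdf is nondecreasing, right-continuous, and
    reaches 1, which amounts to the beta integrand being integrable on [0, 1]
    with a positive integral. The integrand may blow up at both endpoints; it is
    dominated by a combination of v^(m-1) and (1-v)^(n-1), each of which has a
    bounded primitive on ]0, 1[ (integrable_oo_bounded_primitive). *)

(** * Powers on the unit interval and the Kumaraswamy transform *)

Lemma powR_le1 (R : realType) (r x : R) : 0 <= r -> 0 <= x <= 1 -> x `^ r <= 1.
Proof.
move=> r0 /andP[x0 x1]; have : x `^ r <= 1 `^ r.
  by apply: ge0_ler_powR; rewrite ?nnegrE.
by rewrite powR1.
Qed.

Lemma onem_powR_itv (R : realType) (r x : R) : 0 <= r -> 0 <= x <= 1 ->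
  0 <= 1 - x `^ r <= 1.
Proof.
by move=> r0 x01; rewrite subr_ge0 powR_le1//= lerBlDr lerDl powR_ge0.
Qed.

Lemma powR_inv_le (R : realType) (r x y : R) : 0 < r -> 0 <= x -> 0 <= y ->
  (x `^ (1 / r) <= y) = (x <= y `^ r).
Proof.
move=> r0 x0 y0; have rV : x = (x `^ (1 / r)) `^ r.
  by rewrite -powRrM mul1r mulVf ?gt_eqF// powRr1.
rewrite [in RHS]rV; apply/idP/idP => [h|].
  by apply: ge0_ler_powR => //; rewrite ?nnegrE ?powR_ge0// ltW.
by apply: contraTT; rewrite -!ltNge => h; apply: gt0_ltr_powR => //;
  rewrite nnegrE ?powR_ge0.
Qed.

Lemma powR_le_inv (R : realType) (r x y : R) : 0 < r -> 0 <= x -> 0 <= y ->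
  (x `^ r <= y) = (x <= y `^ (1 / r)).
Proof.
move=> r0 x0 y0.
rewrite -{1}[r]invrK -[r^-1^-1]mul1r powR_inv_le ?invr_gt0//.
by rewrite mul1r.
Qed.

(** Unwinds the inequality one power at a time. All the bases stay in [0, 1],
    where each power is inverted by the reciprocal power. *)
Lemma kumaraswamy_galois (R : realType) (a b q g : R) : 0 < a -> 0 < b ->
  0 <= q <= 1 -> 0 <= g <= 1 ->
  (q <= 1 - (1 - g `^ a) `^ b) = ((1 - (1 - q) `^ (1 / b)) `^ (1 / a) <= g).
Proof.
move=> a0 b0 /andP[q0 q1] /andP[g0 g1].
have ga1 : g `^ a <= 1 by rewrite powR_le1 ?g0// ltW.
have q1b : (1 - q) `^ (1 / b) <= 1.
  by rewrite powR_inv_le ?powR1// ?subr_ge0// lerBlDr lerDl.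
rewrite powR_inv_le ?subr_ge0//.
rewrite lerBrDr addrC -lerBrDr powR_le_inv ?subr_ge0//.
by rewrite lerBlDr addrC -lerBlDr.
Qed.

(** * Integrability through a bounded primitive *)

Section integrability.
Context {R : realType}.
Notation mu := (@lebesgue_measure R).

(** The fundamental theorem of calculus bounds the integral of [f] by [C] on
    each compact subinterval of ]0, 1[, and monotone convergence passes the
    bound to the limit; [f] itself may be unbounded near 0 and 1. *)
Lemma integrable_oo_bounded_primitive (f F : R -> R) (C : R) :
  measurable_fun setT f -> (forall x, 0 <= f x) ->
  {in `]0, 1[, continuous f} ->
  {in `]0, 1[, forall x, is_derive x (1 : R) F (f x)} ->
  {in `]0, 1[ &, forall x y, F y - F x <= C} ->
  mu.-integrable `[0, 1] (EFin \o f).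
Proof.
move=> mf f0 cf dF FC.
apply/integrableP; split.
  by apply/measurable_EFinP; exact: measurable_funS mf.
under eq_integral do rewrite /= ger0_norm//.
rewrite integral_itv_bndoo; last first.
  by apply/measurable_EFinP; exact: measurable_funS mf.
(* Denominators start at 3 so that even the first segment is nondegenerate. *)
pose I k : set R := [set` `[k.+3%:R^-1, 1 - k.+3%:R^-1]].
have I01 k x : I k x -> x \in `]0, 1[.
  rewrite /I /= !in_itv/= => /andP[kx xk]; apply/andP; split.
    by apply: lt_le_trans kx; rewrite invr_gt0 ltr0n.
  by apply: le_lt_trans xk _; rewrite ltrBlDr ltrDl invr_gt0 ltr0n.
have UI : \bigcup_k I k = [set` `]0, 1[].
  apply/seteqP; split=> [x [k _]|x]; first exact: I01.
  rewrite /= in_itv/= => /andP[x0 x1].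
  have m0 : 0 < Num.min x (1 - x) by rewrite lt_min x0 subr_gt0.
  have := near_infty_natSinv_lt (PosNum m0).
  move=> [N _ /(_ N (leqnn N))/=]; rewrite lt_min => /andP[Nx Nx1].
  exists N => //; rewrite /I/= in_itv/=.
  have h : N.+3%:R^-1 <= N.+1%:R^-1 :> R.
    by rewrite lef_pV2 ?posrE ?ltr0n// ler_nat; do 2 apply: leqW.
  rewrite (le_trans h (ltW Nx)) lerBrDr -lerBrDl (le_trans h (ltW Nx1))//.
have ndI : nondecreasing_seq I.
  move=> k l kl; rewrite subsetEset => x; rewrite /I/= !in_itv/=.
  have h : l.+3%:R^-1 <= k.+3%:R^-1 :> R.
    by rewrite lef_pV2 ?posrE ?ltr0n// ler_nat !ltnS.
  move: l.+3%:R^-1 k.+3%:R^-1 h => i j h.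
  by move=> /andP[? ?]; apply/andP; split; lra.
have cvI : (\int[mu]_(x in I k) (f x)%:E)%E @[k --> \oo] -->
    (\int[mu]_(x in `]0%R, 1%R[) (f x)%:E)%E.
  rewrite -UI; apply: ge0_nondecreasing_set_cvg_integral => //.
  - by move=> k; exact: measurable_itv.
  - by move=> k; apply/measurable_EFinP; exact: measurable_funS mf.
  - by move=> k x _; rewrite lee_fin.
apply: (@le_lt_trans _ _ C%:E); last exact: ltry.
rewrite -(cvg_lim _ cvI)//.
apply: lime_le; first by apply/cvg_ex; eexists; exact: cvI.
apply: nearW => k.
have k3 : k.+3%:R^-1 <= 3^-1 :> R by rewrite lef_pV2 ?posrE ?ltr0n// ler_nat.
have k0 : 0 < k.+3%:R^-1 :> R by rewrite invr_gt0 ltr0n.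
have kk : k.+3%:R^-1 < 1 - k.+3%:R^-1 :> R.
  by move: (k.+3%:R^-1) k3 k0 => i ? ?; lra.
have F'c x : x \in `]0, 1[ -> {for x, continuous F}.
  move=> /dF Fx; apply: differentiable_continuous; apply/derivable1_diffP.
  exact: ex_derive.
have l01 : k.+3%:R^-1 \in `]0, (1 : R)[.
  by move: (k.+3%:R^-1) k3 k0 => i ? ?; rewrite in_itv/=; lra.
have r01 : 1 - k.+3%:R^-1 \in `]0, (1 : R)[.
  by move: (k.+3%:R^-1) k3 k0 => i ? ?; rewrite in_itv/=; lra.
rewrite (@continuous_FTC2 _ f F)//.
- by rewrite -EFinB lee_fin; exact: FC.
- apply: continuous_in_subspaceT => x /set_mem /I01; exact: cf.
- split.
  + move=> x /subset_itv_oo_cc /I01 /dF h; exact: ex_derive.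
  + by apply: cvg_at_right_filter; exact: F'c.
  + by apply: cvg_at_left_filter; exact: F'c.
- by move=> x /subset_itv_oo_cc /I01 /dF h; rewrite derive1E; exact: derive_val.
Qed.

End integrability.

(** * The quantile as a lower adjoint *)

(** Right-continuity makes the superlevel set of [F] at [u] contain its
    infimum; [l] and [h] only guarantee that this infimum is a genuine one. *)
Lemma quantile_galois (R : realType) (F : R -> R) (u l h : R) :
  {homo F : x y / x <= y} -> right_continuous F ->
  F l < u -> u <= F h -> forall x, (quantile F u <= x) = (u <= F x).
Proof.
move=> ndF rcF Flu uFh x; rewrite /quantile; set E := [set t | _].
have lE : lbound E l.
  move=> t /= uFt; rewrite leNgt; apply/negP => /ltW/ndF Ftl.
  by have := le_lt_trans (le_trans uFt Ftl) Flu; rewrite ltxx.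
have E0 : E !=set0 by exists h.
apply/idP/idP => [qx|uFx]; last by apply: ge_inf => //; exists l.
apply: le_trans (ndF _ _ qx).
apply: (cvgr_to_ge (rcF (inf E))); near=> t.
have /(inf_lt E0) [e uFe et] : inf E < t by near: t; exact: nbhs_right_gt.
by apply: le_trans uFe _; apply/ndF/ltW.
Unshelve. all: by end_near. Qed.

(** * Integrability of the beta integrand *)

Section beta.
Context {R : realType}.
Implicit Types (m n r u v x : R).
Notation mu := (@lebesgue_measure R).

Lemma continuous_powR r x : 0 < x -> {for x, continuous (@powR R ^~ r)}.
Proof.
move=> x0; apply: differentiable_continuous; apply/derivable1_diffP.
by apply: derivable_powR; rewrite in_itv/= x0.
Qed.

Lemma measurable_powR_onem r : measurable_fun setT (fun v => (1 - v) `^ r).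
Proof.
apply: (@measurableT_comp _ _ _ _ _ _ (@powR R ^~ r) _ (fun v => 1 - v)).
  exact: measurable_powR.
exact: measurable_funB.
Qed.

Lemma integrable_powR r : 0 < r ->
  mu.-integrable `[0, 1] (EFin \o (fun v => v `^ (r - 1))).
Proof.
move=> r0.
apply: (integrable_oo_bounded_primitive _ (fun v => r^-1 * v `^ r) r^-1).
- exact: measurable_powR.
- by move=> x; exact: powR_ge0.
- by move=> x; rewrite in_itv/= => /andP[x0 _]; exact: continuous_powR.
- move=> x; rewrite in_itv/= => /andP[x0 _].
  have h : is_derive x (1 : R) (@powR R ^~ r) (r * x `^ (r - 1)).
    exact: is_derive1_powR.
  by apply: is_derive_eq; rewrite /GRing.scale/= mulrA mulVf ?mul1r ?gt_eqF.
- move=> x y; rewrite !in_itv/= => /andP[x0 x1] /andP[y0 y1].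
  rewrite -mulrBr -[leRHS]mulr1 ler_pM2l ?invr_gt0//.
  rewrite lerBlDr (@le_trans _ _ 1) ?lerDl ?powR_ge0//.
  by rewrite powR_le1 ?(ltW r0) ?(ltW y0) ?(ltW y1).
Qed.

Lemma integrable_powR_onem r : 0 < r ->
  mu.-integrable `[0, 1] (EFin \o (fun v => (1 - v) `^ (r - 1))).
Proof.
move=> r0.
apply: (integrable_oo_bounded_primitive _
  (fun v => - (r^-1 * (1 - v) `^ r)) r^-1).
- exact: measurable_powR_onem.
- by move=> x; exact: powR_ge0.
- move=> x; rewrite in_itv/= => /andP[_ x1].
  apply: (@continuous_comp _ _ _ (fun v => 1 - v) (@powR R ^~ (r - 1))).
    by apply: cvgB; [exact: cvg_cst|exact: cvg_id].
  by apply: continuous_powR; rewrite subr_gt0.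
- move=> x; rewrite in_itv/= => /andP[_ x1].
  have x10 : 0 < 1 - x by rewrite subr_gt0.
  have h : is_derive x (1 : R) (fun v => (1 - v) `^ r)
      ((r * (1 - x) `^ (r - 1)) * -1).
    apply: (@is_derive1_comp _ (@powR R ^~ r) (fun v => 1 - v)).
      exact: is_derive1_powR.
    by apply: is_derive_eq; rewrite add0r mul1r.
  apply: is_derive_eq.
  by rewrite /GRing.scale/= mulrN1 mulrN opprK mulrA mulVf ?mul1r ?gt_eqF.
- move=> x y; rewrite !in_itv/= => /andP[x0 x1] /andP[y0 y1].
  rewrite opprK addrC -mulrBr -[leRHS]mulr1 ler_pM2l ?invr_gt0//.
  rewrite lerBlDr (@le_trans _ _ 1) ?lerDl ?powR_ge0//.
  by rewrite powR_le1 ?(ltW r0)// subr_ge0 lerBlDr lerDl !ltW.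
Qed.

(** The exponent may have either sign: the power is at most 1 when it is
    nonnegative and is largest at 1/2 otherwise; the sum covers both cases. *)
Lemma powR_half_le r v : 2^-1 <= v -> v <= 1 -> v `^ r <= 1 + 2^-1 `^ r.
Proof.
move=> v2 v1; have v0 : 0 < v by apply: lt_le_trans v2; rewrite invr_gt0.
have [r0|r0] := leP 0 r.
  by rewrite (@le_trans _ _ 1) ?lerDl ?powR_ge0// powR_le1 ?(ltW v0).
have -> : r = - (- r) by rewrite opprK.
rewrite !(powRN _ (- r)) (@le_trans _ _ (2^-1 `^ (- r))^-1) ?lerDr//.
rewrite lef_pV2 ?posrE ?powR_gt0 ?invr_gt0//.
by apply: ge0_ler_powR; rewrite ?nnegrE ?oppr_ge0 ?invr_ge0// ltW.
Qed.

Lemma beta_integrand_ge0 m n v : 0 <= beta_integrand m n v.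
Proof. by rewrite mulr_ge0// powR_ge0. Qed.

(** On either half of [0, 1], one of the two factors stays bounded while the
    other carries the possible singularity. *)
Lemma beta_integrand_le m n v : 0 <= v <= 1 ->
  beta_integrand m n v <= (1 + 2^-1 `^ (n - 1)) * v `^ (m - 1) +
    (1 + 2^-1 `^ (m - 1)) * (1 - v) `^ (n - 1).
Proof.
move=> /andP[v0 v1]; rewrite /beta_integrand.
have [v2|v2] := leP 2^-1 v.
  rewrite (@le_trans _ _ ((1 + 2^-1 `^ (m - 1)) * (1 - v) `^ (n - 1)))//.
    by rewrite ler_wpM2r ?powR_ge0 ?powR_half_le.
  by rewrite lerDr mulr_ge0 ?addr_ge0 ?powR_ge0.
rewrite (@le_trans _ _ ((1 + 2^-1 `^ (n - 1)) * v `^ (m - 1)))//.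
  rewrite mulrC ler_wpM2r ?powR_ge0 ?powR_half_le//; lra.
by rewrite lerDl mulr_ge0 ?addr_ge0 ?powR_ge0.
Qed.

Lemma measurable_beta_integrand m n : measurable_fun setT (beta_integrand m n).
Proof.
apply: measurable_funM; first exact: measurable_powR.
exact: measurable_powR_onem.
Qed.

Lemma integrable_beta_integrand m n : 0 < m -> 0 < n ->
  mu.-integrable `[0, 1] (EFin \o beta_integrand m n).
Proof.
move=> m0 n0.
have ig : mu.-integrable `[0, 1] (EFin \o (fun v =>
    (1 + 2^-1 `^ (n - 1)) * v `^ (m - 1) +
    (1 + 2^-1 `^ (m - 1)) * (1 - v) `^ (n - 1))).
  apply: (integrableD _ (integrableZl _ (1 + 2^-1 `^ (n - 1))
                          (integrable_powR m m0))
                        (integrableZl _ (1 + 2^-1 `^ (m - 1))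
                          (integrable_powR_onem n n0)));
    exact: measurable_itv.
apply: le_integrable ig => //.
  apply/measurable_EFinP.
  by apply: measurable_funS (measurable_beta_integrand _ _).
move=> x /=; rewrite in_itv/= => x01; rewrite lee_fin ger0_norm.
  exact: le_trans (beta_integrand_le _ _ _ x01) (ler_norm _).
exact: beta_integrand_ge0.
Qed.

(** A zero integral would make the nonnegative integrand vanish almost
    everywhere, whereas it is positive on ]0, 1[. *)
Lemma rbeta_fun_gt0 m n : 0 < m -> 0 < n -> 0 < rbeta_fun m n.
Proof.
move=> m0 n0; have ib := integrable_beta_integrand m n m0 n0.
rewrite lt0r Rintegral_ge0 ?andbT; last by move=> *; exact: beta_integrand_ge0.
apply/eqP => B0.
have : (\int[mu]_(v in `[0%R, 1%R]) `|(beta_integrand m n v)%:E| = 0)%E.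
  under eq_integral do rewrite gee0_abs ?lee_fin ?beta_integrand_ge0//.
  by rewrite -[LHS]fineK ?[fine _]B0// integrable_fin_num.
move/ae_eq_integral_abs => /(_ (measurable_itv _) (measurable_int _ ib)).
move=> [N [mN N0 sub]].
have : (mu `]0%R, 1%R[ <= mu N)%E.
  apply: le_measure; rewrite ?inE//.
  move=> x /=; rewrite in_itv/= => /andP[x0 x1]; apply: sub => /=.
  move=> /(_ _)/eqP; rewrite in_itv/= (ltW x0) (ltW x1) => /(_ isT).
  by rewrite eqe mulf_eq0 !powR_eq0 (subr_eq0 1) (gt_eqF x0) (gt_eqF x1).
by rewrite N0 lebesgue_measure_itv/= lte01 oppr0 adde0 leNgt lte01.
Qed.

(** * The cdf of the beta distribution *)

Lemma le_reg_inc_beta m n : 0 < m -> 0 < n ->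
  {in `[0, 1] &, {homo reg_inc_beta m n : x y / x <= y}}.
Proof.
move=> m0 n0 x y; rewrite !in_itv/= => /andP[x0 x1] /andP[y0 y1] xy.
have ib := integrable_beta_integrand m n m0 n0.
rewrite /reg_inc_beta ler_pM2l ?invr_gt0 ?rbeta_fun_gt0//.
have iS z : z <= 1 -> mu.-integrable `[0, z] (EFin \o beta_integrand m n).
  move=> z1; apply: integrableS ib => //.
  by apply: subset_itvl; rewrite bnd_simp.
apply: fine_le; [exact: integrable_fin_num (iS x x1)|
                 exact: integrable_fin_num (iS y y1)|].
apply: ge0_subset_integral => //.
- exact: measurable_int (iS y y1).
- by move=> *; rewrite lee_fin beta_integrand_ge0.
- by apply: subset_itvl; rewrite bnd_simp.
Qed.

Lemma reg_inc_beta0 m n : reg_inc_beta m n 0 = 0.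
Proof. by rewrite /reg_inc_beta set_itv1 Rintegral_set1 mulr0. Qed.

Lemma reg_inc_beta1 m n : 0 < m -> 0 < n -> reg_inc_beta m n 1 = 1.
Proof. by move=> m0 n0; apply: mulVf; rewrite gt_eqF ?rbeta_fun_gt0. Qed.

Lemma beta_cdfE m n x : 0 < m -> 0 < n -> 0 <= x <= 1 ->
  beta_cdf m n x = reg_inc_beta m n x.
Proof.
move=> m0 n0 /andP[x0 x1]; rewrite /beta_cdf.
have [x0'|x0'] := leP x 0.
  by rewrite (_ : x = 0) ?reg_inc_beta0//; apply/le_anti/andP.
have [x1'|//] := leP 1 x.
by rewrite (_ : x = 1) ?reg_inc_beta1//; apply/le_anti/andP.
Qed.

Lemma le_beta_cdf m n : 0 < m -> 0 < n -> {homo beta_cdf m n : x y / x <= y}.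
Proof.
move=> m0 n0 x y xy.
(* The cdf is the regularized integral precomposed with clamping to [0, 1]. *)
pose c z : R := Num.max 0 (Num.min z 1).
have c01 z : c z \in `[0, 1].
  by rewrite in_itv/= le_max lexx ge_max ler01 ge_min lexx orbT.
have cE z : beta_cdf m n z = reg_inc_beta m n (c z).
  rewrite /beta_cdf /c; have [z0|z0] := leP z 0.
    by rewrite max_l ?reg_inc_beta0// ge_min z0.
  have [z1|z1] := leP 1 z.
    by rewrite max_r ?ler01 ?reg_inc_beta1.
  by rewrite max_r// ltW.
rewrite !cE; apply: le_reg_inc_beta => //.
by rewrite /c ge_max !le_max !le_min !ge_min !lexx xy /= !(orbT, andbT).
Qed.

Lemma beta_cdf_right_continuous m n : 0 < m -> 0 < n ->
  right_continuous (beta_cdf m n).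
Proof.
move=> m0 n0 x.
have cI : {within `[0, 1], continuous (reg_inc_beta m n)}.
  move=> z; apply: cvgM; first exact: cvg_cst.
  apply: parameterized_integral_continuous => //.
  exact: integrable_beta_integrand.
have [x0|x0] := ltP x 0.
  rewrite [in X in _ --> X]/beta_cdf ltW//.
  apply: cvg_near_cst; near=> z.
  by rewrite /beta_cdf ltW//; near: z; exact: nbhs_right_lt.
have [x1|x1] := leP 1 x.
  rewrite [in X in _ --> X]/beta_cdf x1 leNgt (lt_le_trans ltr01 x1)/=.
  apply: cvg_near_cst; near=> z.
  have xz : x < z by near: z; exact: nbhs_right_gt.
  have z1 : 1 < z by exact: le_lt_trans xz.
  by rewrite /beta_cdf leNgt (lt_trans ltr01 z1)/= ltW.
rewrite beta_cdfE ?x0 ?(ltW x1)//.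
apply: cvg_trans (_ : reg_inc_beta m n @ x^'+ --> reg_inc_beta m n x).
  apply: near_eq_cvg; near=> z; rewrite beta_cdfE//; apply/andP; split.
    by apply: le_trans x0 _; near: z; exact: nbhs_right_ge.
  by near: z; apply: nbhs_right_le.
have /(continuous_within_itvP _ ltr01)[ci c0 _] := cI.
move: x0; rewrite le_eqVlt => /predU1P[<-//|x0].
by apply: cvg_at_right_filter; apply: ci; rewrite in_itv/= x0.
Unshelve. all: by end_near. Qed.

End beta.

(** * The quantile function of the Beta Kumaraswamy-G distribution *)

Theorem mainTheorem8 (R : realType) (G : R -> R)
    (hG : abs_continuous_positive_cdf G)
    (a b m n : R) (ha : 0 < a) (hb : 0 < b) (hm : 0 < m) (hn : 0 < n)
    (u : R) (hu0 : 0 < u) (hu1 : u < 1) :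
  quantile (bkwg_cdf G a b m n) u =
  quantile G ((1 - (1 - beta_quantile m n u) `^ (1 / b)) `^ (1 / a)).
Proof.
have G01 t : 0 <= G t <= 1.
  have [P [_ _ PG]] := hG.
  by rewrite -!lee_fin PG measure_ge0 probability_le1.
have qP := quantile_galois _ _ _ 0 1 (le_beta_cdf _ _ hm hn)
  (beta_cdf_right_continuous _ _ hm hn).
have {}qP x : (beta_quantile m n u <= x) = (u <= beta_cdf m n x).
  by apply: qP; rewrite beta_cdfE ?lexx ?ler01// ?reg_inc_beta0//
    reg_inc_beta1// ltW.
have q01 : 0 <= beta_quantile m n u <= 1.
  rewrite qP beta_cdfE ?lexx ?ler01// reg_inc_beta1// (ltW hu1) andbT.
  by rewrite leNgt; apply/negP => /ltW; rewrite qP /beta_cdf lexx leNgt hu0.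
rewrite /quantile; congr inf; apply: eq_set => t.
rewrite -kumaraswamy_galois// qP beta_cdfE//.
by rewrite !onem_powR_itv ?(ltW ha) ?(ltW hb).
Qed.
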